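(* Let $K$ be a finite field of characteristic $2$, and $F = K(x, y)$, where $K(x)$ is a rational function field over $K$ and $y$ satisfies an irreducible quadratic equation over $K(x)$ $$y^2 + y = \frac{C(x)}{B(x)^2}$$ in Hasse normal form. Denote the integral closure of $K[x]$ in $F$ by $\mathcal{O}_F$. Then the following two statements are equivalent. (a) $u(\mathcal{O}_F) = \omega$. (b) We have $\deg B = 1$ and either $\deg C \leq 1$, or $\deg C = 2$ and the leading coefficient of $C$ is of the form $a^2 + a$, for some $a \in K$.
   Context: Hasse normal form: the equation is of the form $$y^2 + y = \frac{g(x)}{p_1(x)^{2 n_1 - 1} \cdots p_m(x)^{2 n_m - 1}},$$ where $p_1, \ldots, p_m \in K[X]$ ($m \geq 0$) are monic irreducible polynomials, distinct from each other, $n_1, \ldots, n_m$ are positive integers, $g \in K[X]$ is not divisible by any of the $p_i$, and the infinite place of $K(x)$ is either no pole or a pole of odd order of the right-hand side (that is, the degree of the denominator minus the degree of the numerator is non-negative or odd). One puts $B := p_1^{n_1}\cdots p_m^{n_m}$ and $C := g\, p_1 \cdots p_m$, so that the right-hand side equals $C(x)/B(x)^2$. Unit sum number: let $R$ be a ring with identity and $k$ a positive integer. An element $r \in R$ is $k$-good if there are units $e_1, \ldots, e_k$ of $R$ with $r = e_1 + \cdots + e_k$. The ring $R$ is $k$-good if every element of $R$ is $k$-good. The unit sum number is $u(R) := \min\{k \mid R \text{ is } k\text{-good}\}$ if this minimum exists; if it does not exist but $R$ is additively generated by its units, then $u(R) := \omega$; if the units do not generate $R$ additively, then $u(R) :=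 \infty$. *)

(* Defs.v *)
From HB Require Import structures.
From mathcomp Require Import all_boot all_order all_algebra all_field.
From mathcomp Require Import boolp.
Set Implicit Arguments.
Unset Strict Implicit.
Unset Printing Implicit Defensive.
Import GRing.Theory.
Local Open Scope ring_scope.

Section IntegralClosure.
Variables (A : comNzRingType) (E : fieldType) (f : {rmorphism A -> E}).

Definition integral_pred : {pred E} := fun u => `[< integralOver f u >].

Record integral_closure :=
  IntegralClosure { ic_val : E; _ : ic_val \in integral_pred }.

Lemma integral_predP u : reflect (integralOver f u) (u \in integral_pred).
Proof. exact: asboolP. Qed.

Lemma integral_pred_subring : subring_closed integral_pred.
Proof.
split=> [|u v /integral_predP hu /integral_predP hv
         |u v /integral_predP hu /integral_predP hv]; apply/integral_predP.
- exact: integral1.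
- exact: integral_sub.
- exact: integral_mul.
Qed.

HB.instance Definition _ :=
  GRing.isSubringClosed.Build E integral_pred integral_pred_subring.
HB.instance Definition _ := [isSub for ic_val].
HB.instance Definition _ := [Choice of integral_closure by <:].
HB.instance Definition _ := [SubChoice_isSubComNzRing of integral_closure by <:].

Definition ic_unit : pred integral_closure :=
  fun u => `[< exists v, v * u = 1 >].

(* Outside the units the inverse is the identity, as [unitRingType] demands. *)
Definition ic_inv (u : integral_closure) : integral_closure :=
  match pselect (exists v, v * u = 1) with
  | left ex_v => projT1 (cid ex_v)
  | right _ => u
  end.

Lemma ic_mulVr : {in ic_unit, left_inverse 1 ic_inv *%R}.
Proof.
move=> u /asboolP ex_v; rewrite /ic_inv.
by case: pselect => // ex_v'; case: (cid ex_v').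
Qed.

Lemma ic_unitP u v : v * u = 1 -> ic_unit u.
Proof. by move=> vu1; apply/asboolP; exists v. Qed.

Lemma ic_inv_out : {in [predC ic_unit], ic_inv =1 id}.
Proof.
move=> u /negP nu; rewrite /ic_inv; case: pselect => // ex_v.
by case: nu; apply/asboolP.
Qed.

HB.instance Definition _ :=
  GRing.ComNzRing_hasMulInverse.Build integral_closure
    ic_mulVr ic_unitP ic_inv_out.

End IntegralClosure.

Section UnitSumNumber.
Variable R : unitRingType.

Definition good_elt (k : nat) (r : R) : Prop :=
  exists e : 'I_k -> R,
    (forall i, e i \is a GRing.unit) /\ r = \sum_(i < k) e i.

Definition good_ring (k : nat) : Prop := (0 < k)%N /\ forall r, good_elt k r.

Definition generated_by_units : Prop :=
  forall S : {pred R}, zmod_closed S ->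
    (forall e, e \is a GRing.unit -> e \in S) -> forall r, r \in S.

(* [usn_omega] and [usn_infty] stand for the symbols omega and infinity. *)
Inductive usn_value := usn_fin of nat | usn_omega | usn_infty.

Lemma ex_good_ringb :
  (exists k, good_ring k) -> exists k, `[< good_ring k >].
Proof. by case=> k ?; exists k; apply/asboolP. Qed.

Definition unit_sum_number : usn_value :=
  match pselect (exists k, good_ring k) with
  | left ex_k => usn_fin (ex_minn (ex_good_ringb ex_k))
  | right _ => if pselect generated_by_units then usn_omega else usn_infty
  end.

End UnitSumNumber.

Section HasseNormalForm.
Variables (K : fieldType) (m : nat).
Variables (p : 'I_m -> {poly K}) (n : 'I_m -> nat) (g : {poly K}).

(* [2 * n i - 1] is a truncated subtraction, harmless since [0 < n i]; then
   [g / hasse_den = hasse_C / hasse_B ^+ 2] in the fraction field. *)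
Definition hasse_den : {poly K} := \prod_(i < m) p i ^+ (2 * n i - 1).
Definition hasse_B : {poly K} := \prod_(i < m) p i ^+ n i.
Definition hasse_C : {poly K} := g * \prod_(i < m) p i.

(* [hnf_infty] says that the infinite place is no pole of [g / hasse_den] or a
   pole of odd order: for nonzero [g] the differences of sizes are those of
   degrees, and a zero [g] falls under the first disjunct. *)
Record hasse_normal_form : Prop := HasseNormalForm {
  hnf_monic : forall i, p i \is monic;
  hnf_irr : forall i, irreducible_poly (p i);
  hnf_inj : injective p;
  hnf_pos : forall i, (0 < n i)%N;
  hnf_ndvd : forall i, ~~ (p i %| g);
  hnf_infty : (size g <= size hasse_den)%N \/ odd (size g - size hasse_den)
}.

End HasseNormalForm.

Section IntegralClosureOfPolynomials.
Variables (K : fieldType) (F : fieldExtType {fraction {poly K}}).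

Definition poly_to_ext : {rmorphism {poly K} -> F} :=
  in_alg F \o @FracField.tofrac {poly K}.

Definition poly_integral_closure := integral_closure poly_to_ext.

End IntegralClosureOfPolynomials.

Notation "''O_' F" := (poly_integral_closure F)
  (at level 8, F at level 2, format "''O_' F").

(* Main.v *)
(* Put [w = B y], so that [w^2 = C - B w]. The Hasse normal form makes [1, w] a
   [K[x]]-basis of [O_F], and the units are the [a + b w] whose norm
   [a^2 - a b B - b^2 C] is a nonzero constant.

   Let [e = a0 + b0 w] be a unit with [b0 <> 0] of least degree, and [T] its
   trace, which is [b0 B] up to sign. If [deg T > 0], then for every unit [u]
   with nonzero [w]-coordinate one of [u e] and [u e'], where [e'] is the
   conjugate of [e], has a [w]-coordinate of smaller degree; hence all units lie
   in [K[e, e'] = K[T] + K[T] e]. If they generate [O_F], then [w] and [x] lie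
   there, so [b0] is constant and [deg T = 1], that is [deg B = 1]; the existence
   of a unit [a + w] then restricts [C]. When [B = 1], the condition at infinity
   and the irreducibility of the quadratic only leave constant [a] in units.

   Conversely, under (b) some [e = a0 + w] is a unit, [x] is a polynomial in [e]
   and its inverse, and [O_F = K[e, 1/e]] is a ring of Laurent polynomials: its
   units are the monomials, which generate it, but a sum of [k] of them has at
   most [k] nonzero coefficients. *)
Require Import Defs.
From HB Require Import structures.
From mathcomp Require Import all_boot all_order all_algebra all_field.
From mathcomp Require Import boolp ring zify.
Import GRing.Theory.
Local Open Scope ring_scope.
Set Implicit Arguments.
Unset Strict Implicit.

Local Notation tofrac := FracField.tofrac.

(** * Integrality over polynomial rings *)

Lemma tofrac_inj (R : idomainType) : injective (@tofrac R).
Proof. by move=> a b /eqP; rewrite tofrac_eq => /eqP. Qed.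

Lemma fraction_numden (R : idomainType) (z : {fraction R}) :
  exists n d : R, d != 0 /\ z * tofrac d = tofrac n.
Proof.
elim/quotW: z => x; exists x.1, x.2; split; first exact: denom_ratioP.
have d0 := denom_ratioP x.
unlock FracField.tofrac; rewrite -[LHS]/(FracField.mul _ _) -FracField.pi_mul.
apply/eqmodP; rewrite /= FracField.equivfE /FracField.mulf.
by rewrite !numden_Ratio ?mulf_neq0 ?oner_neq0 // !mulr1 mulrC.
Qed.

Lemma fraction_poly_coprime (K : fieldType) (z : {fraction {poly K}}) :
  exists n d : {poly K}, [/\ d != 0, coprimep n d & z * tofrac d = tofrac n].
Proof.
have [n [d [d0 zdn]]] := fraction_numden z.
pose h := gcdp n d.
have h0 : h != 0 by rewrite gcdp_eq0 negb_and d0 orbT.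
have hd := divpK (dvdp_gcdr n d); have hn := divpK (dvdp_gcdl n d).
exists (n %/ h), (d %/ h); split.
- by apply: contraNneq d0 => q0; rewrite -hd q0 mul0r.
- by rewrite coprimep_div_gcd ?d0 ?orbT.
- apply: (@mulIf _ (tofrac h)); first by rewrite tofrac_eq0.
  by rewrite -mulrA -!rmorphM /= hd hn.
Qed.

(** The rational root argument: multiplying the monic equation by a power of the denominator [d] of
    a reduced fraction shows that [d] divides a power of the numerator, hence is constant. *)
Lemma fraction_poly_integral (K : fieldType) (z : {fraction {poly K}}) :
  integralOver (@tofrac {poly K}) z -> exists a, z = tofrac a.
Proof.
case=> q mon_q /rootP q0.
have [n [d [d0 cop zd]]] := fraction_poly_coprime z.
have size_q : size q = (size q).-1.+1.
  by rewrite prednK // lt0n size_poly_eq0 monic_neq0.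
set s := (size q).-1 in size_q.
have zdX i : (i <= s)%N ->
    z ^+ i * tofrac (d ^+ s) = tofrac (n ^+ i * d ^+ (s - i)).
  move=> le_is; rewrite -{1}(subnKC le_is) exprD rmorphM /= mulrA.
  by rewrite [tofrac (d ^+ i)]rmorphXn /= -exprMn zd [RHS]rmorphM -rmorphXn.
have d_unit : d %| n ^+ s.
  have: \sum_(i < s.+1) q`_i * (n ^+ i * d ^+ (s - i)) = 0.
    apply/eqP; rewrite -tofrac_eq0 rmorph_sum /=.
    have := congr1 (fun u => u * tofrac (d ^+ s)) q0.
    rewrite horner_coef (size_map_inj_poly (@tofrac_inj _) (rmorph0 _)) size_q.
    rewrite mulr_suml mul0r => {2}<-.
    apply/eqP/eq_bigr => i _.
    have /zdX zdi : (i <= s)%N by rewrite -ltnS.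
    by rewrite coef_map /= -mulrA zdi rmorphM.
  rewrite big_ord_recr /= subnn mulr1 -lead_coefE (monicP mon_q) mul1r.
  move/eqP; rewrite addrC addr_eq0 => /eqP->; rewrite dvdpNr.
  apply: (big_ind (fun u => d %| u)) => // [u v|i _]; first exact: dvdp_add.
  by rewrite -subnSK ?ltn_ord // exprS; do 2!apply: dvdp_mull; apply: dvdp_mulr.
have: d %| 1.
  have [[u v]] := Bezout_eq1_coprimepP _ _ (coprimep_expl s cop).
  move=> /= <-; apply: dvdp_add; first exact: dvdp_mull.
  exact: dvdp_mull.
rewrite dvdp1 => /size_poly1P[k k0 dk].
exists (n * k^-1%:P); apply: (mulIf (x := tofrac d)); first by rewrite tofrac_eq0.
by rewrite zd -rmorphM dk /= -mulrA -polyCM mulVf // mulr1.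
Qed.

(** * Irreducible divisors of norms *)

Lemma irreducible_dvdpX (R : idomainType) (p q : {poly R}) k :
  irreducible_poly p -> p %| q ^+ k -> p %| q.
Proof.
move=> irr_p; apply: contraTT => nd.
rewrite -irreducible_poly_coprime // coprimep_expr //.
by rewrite irreducible_poly_coprime.
Qed.

Section Dvdp.
Variable K : fieldType.
Implicit Types a b p B C g : {poly K}.

(* The norm of [a + b w] when [w ^+ 2 = C - B w]. *)
Definition qnorm B C a b := a ^+ 2 - a * b * B - b ^+ 2 * C.

(** The arguments on the left are the coordinates of [(a + b w) (a' + b' w)]. *)
Lemma qnormM B C a b a' b' :
  qnorm B C (a * a' + b * b' * C) (a * b' + a' * b - b * b' * B)
  = qnorm B C a b * qnorm B C a' b'.
Proof. by rewrite /qnorm; ring. Qed.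

(* The exponents of [p] in [a ^+ 2] and [b ^+ 2 * C] have different parities,
   so no cancellation can make the norm more divisible by [p] than they are. *)
Lemma irreducible_dvdp_qnorm p B g n a b k :
    irreducible_poly p -> p %| B -> ~~ (p %| g) ->
    p ^+ (2 * n) %| qnorm B (p * g) a b -> (k <= n)%N ->
  p ^+ k %| a /\ p ^+ k %| b.
Proof.
move=> irr_p pB npg dvdN; elim: k => [|k IHk] lt_kn.
  by rewrite expr0 !dvd1p.
have [/dvdpP[a1 defa] /dvdpP[b1 defb]] := IHk (ltnW lt_kn).
have p0 := irredp_neq0 irr_p.
have pk0 : p ^+ k != 0 by rewrite expf_neq0.
(* As [k < n], the quotient pair still has a norm divisible by [p ^+ 2]. Modulo [p] this gives
   [p %| a1], and then modulo [p ^+ 2] it gives [p %| b1]. *)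
have dvd2 : p ^+ 2 %| qnorm B (p * g) a1 b1.
  rewrite -(@dvdp_mul2l _ (p ^+ k ^+ 2)) ?expf_neq0 //.
  have -> : p ^+ k ^+ 2 * qnorm B (p * g) a1 b1 = qnorm B (p * g) a b.
    by rewrite /qnorm defa defb; ring.
  apply: (dvdp_trans _ dvdN); rewrite -exprM -exprD dvdp_exp2l //; lia.
have pa : p %| a1.
  apply: (@irreducible_dvdpX _ _ _ 2 irr_p).
  have -> : a1 ^+ 2 = qnorm B (p * g) a1 b1 + (a1 * b1 * B + p * (b1 ^+ 2 * g)).
    by rewrite /qnorm; ring.
  apply: dvdp_add; first by apply: (dvdp_trans _ dvd2); rewrite expr2 dvdp_mulr.
  by apply: dvdp_add; [apply: dvdp_mull | apply: dvdp_mulr].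
have pb : p %| b1.
  apply: (@irreducible_dvdpX _ _ _ 2 irr_p).
  have : p ^+ 2 %| p * (b1 ^+ 2 * g).
    have -> : p * (b1 ^+ 2 * g) =
      a1 ^+ 2 - a1 * b1 * B - qnorm B (p * g) a1 b1 by rewrite /qnorm; ring.
    apply: (dvdp_sub _ dvd2); apply: dvdp_sub; first exact: dvdp_exp2r.
    by rewrite expr2 dvdp_mul // dvdp_mulr.
  rewrite expr2 dvdp_mul2l // Gauss_dvdpl //.
  by rewrite irreducible_poly_coprime.
rewrite !exprSr defa defb.
by rewrite !(mulrC _ (p ^+ k)) !dvdp_mul2l.
Qed.

Lemma monic_irreducible_coprimep p q :
    p \is monic -> q \is monic -> irreducible_poly p -> irreducible_poly q ->
  p != q -> coprimep p q.
Proof.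
move=> mp mq ip iq; apply: contraNT; rewrite irreducible_poly_coprime // negbK.
by move=> pq; rewrite -eqp_monic // iq //; case: ip => /ltn_eqF; rewrite eq_sym => ->.
Qed.

Lemma prod_coprimep_dvdp m (q : 'I_m -> {poly K}) a :
    (forall i j, i != j -> coprimep (q i) (q j)) -> (forall i, q i %| a) ->
  \prod_i q i %| a.
Proof.
elim: m q => [|m IHm] q cop dvd; first by rewrite big_ord0 dvd1p.
rewrite big_ord_recl Gauss_dvdp ?dvd ?IHm // => [i j ne|].
  by rewrite cop // (inj_eq lift_inj).
apply: (big_ind (coprimep _)) => [|u v|i _]; first exact: coprimep1.
  by rewrite coprimepMr => -> ->.
exact: cop.
Qed.

End Dvdp.

(** * Consequences of the Hasse normal form *)

Section HasseNormalForm.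
Variables (K : fieldType) (m : nat).
Variables (p : 'I_m -> {poly K}) (n : 'I_m -> nat) (g : {poly K}).
Hypothesis hnf : hasse_normal_form p n g.
Local Notation B := (hasse_B p n).
Local Notation C := (hasse_C p g).

Lemma hasse_B_monic : B \is monic.
Proof. by apply: monic_prod => i _; apply/monic_exp/(hnf_monic hnf). Qed.

Lemma hasse_denE : hasse_den p n * \prod_i p i = B ^+ 2.
Proof.
rewrite -prodrXl -big_split; apply: eq_bigr => i _ /=.
by rewrite -exprSr -exprM; congr (_ ^+ _); have := hnf_pos hnf i; lia.
Qed.

(** Passing from [g / hasse_den] to [C / B ^+ 2] multiplies numerator and denominator by the same
    product, so the difference of degrees is unchanged. *)
Lemma hasse_infty :
  (size C <= size (B ^+ 2))%N \/ odd (size C - size (B ^+ 2)).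
Proof.
have mP : \prod_i p i \is monic by apply: monic_prod => i _; apply: (hnf_monic hnf).
have mD : hasse_den p n \is monic.
  by apply: monic_prod => i _; apply/monic_exp/(hnf_monic hnf).
have [g0|g0] := eqVneq g 0.
  by left; rewrite /hasse_C g0 mul0r size_poly0.
rewrite /hasse_C -hasse_denE size_Mmonic // size_Mmonic ?monic_neq0 //.
have P0 : (0 < size (\prod_i p i)%R)%N by rewrite lt0n size_poly_eq0 monic_neq0.
by move: P0 (hnf_infty hnf); move: (size (\prod_i p i)%R) => sP; lia.
Qed.

(** This will force integral elements into the span of [1] and [w]. It holds locally because each
    [p i] divides [C] exactly once, and the local statements combine by coprimality. *)
Lemma hasse_dvdp a b : B ^+ 2 %| qnorm B C a b -> B %| a /\ B %| b.
Proof.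
move=> dvdN.
have cop i j : i != j -> coprimep (p i) (p j).
  move=> ne_ij; apply: monic_irreducible_coprimep;
    by [apply: hnf_monic hnf _ | apply: hnf_irr hnf _
       | rewrite (inj_eq (hnf_inj hnf))].
have main i : p i ^+ n i %| a /\ p i ^+ n i %| b.
  have dvdB : p i ^+ n i %| B by rewrite /hasse_B (bigD1 i) //= dvdp_mulr.
  have CE : C = p i * (g * \prod_(j | j != i) p j).
    by rewrite /hasse_C (bigD1 i) //= mulrCA.
  have dvdN' :
      p i ^+ (2 * n i) %| qnorm B (p i * (g * \prod_(j | j != i) p j)) a b.
    by rewrite -CE; apply: dvdp_trans dvdN; rewrite mulnC exprM dvdp_exp2r.
  apply: (@irreducible_dvdp_qnorm _ (p i) B _ (n i) a b) dvdN' (leqnn _).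
  - exact: hnf_irr hnf i.
  - by apply: dvdp_trans dvdB; rewrite dvdp_exp // (hnf_pos hnf).
  - rewrite -irreducible_poly_coprime; last exact: hnf_irr hnf i.
    rewrite coprimepMr irreducible_poly_coprime; last exact: hnf_irr hnf i.
    rewrite (hnf_ndvd hnf); apply: (big_ind (coprimep _)) => [|u v|j ne_ji].
    + exact: coprimep1.
    + by rewrite coprimepMr => -> ->.
    + by rewrite cop // eq_sym.
split; apply: prod_coprimep_dvdp => [i j ne_ij|i];
  by [rewrite coprimep_expl ?coprimep_expr ?cop | case: (main i)].
Qed.

End HasseNormalForm.

(** * Pairs of polynomials of constant norm *)

Section NormOne.
Variables (K : fieldType) (charK : 2%N \in [pchar K]) (B C : {poly K}).
Implicit Types a b f h : {poly K}.

Lemma poly_mulr2n a : a *+ 2 = 0.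
Proof. by rewrite -mulr_natl -(rmorph_nat polyC) (pcharf0 charK) rmorph0 mul0r. Qed.

Lemma poly_oppr a : - a = a.
Proof. by apply/esym/eqP; rewrite -subr_eq0 opprK -mulr2n poly_mulr2n. Qed.

(** * Descent on units *)

Section Descent.
Variables (a0 b0 : {poly K}).
Hypothesis size_N0 : size (qnorm B C a0 b0) = 1%N.
Hypothesis b0_min :
  forall a b, size (qnorm B C a b) = 1%N -> b != 0 -> (size b0 <= size b)%N.
Hypothesis size_b0B : (1 < size (b0 * B)%R)%N.

Let T := a0 *+ 2 - b0 * B.

(* [T] is the trace of [a0 + b0 w], so this is membership in the ring
   generated by that unit and its conjugate. *)
Definition in_unit_order a b :=
  exists f h, a = (f \Po T) + (h \Po T) * a0 /\ b = (h \Po T) * b0.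

(** The two polynomials are the [w]-coordinates of the products of [a + b w] with [a0 + b0 w] and
    with its conjugate. *)
Lemma unit_descent a b :
    size (qnorm B C a b) = 1%N -> b != 0 ->
    (size (a * b0 + a0 * b - b * b0 * B)%R < size b)%N
  \/ (size (a0 * b - a * b0)%R < size b)%N.
Proof.
move=> size_N bn0.
set b1 := a * b0 + _ - _; set b2 := a0 * b - _.
have [|le1] := ltnP (size b1) (size b); first by left.
have [|le2] := ltnP (size b2) (size b); first by right.
have le0 := b0_min size_N bn0.
(* If both were at least as large as [b], [eqM] would force them to have the
   size of [b], which is too small for their sum by [eqD]. *)
have eqM : b1 * b2 = b ^+ 2 * qnorm B C a0 b0 - b0 ^+ 2 * qnorm B C a b.
  by rewrite /b1 /b2 /qnorm; ring.
have eqD : b1 + b2 = b * (b0 * B).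
  rewrite -[b2]poly_oppr -[LHS]subr0 -[RHS]poly_oppr -(poly_mulr2n (a * b0)).
  by rewrite /b1 /b2; ring.
have b0B : b0 * B != 0 by rewrite -size_poly_gt0 ltnW.
have b00 : b0 != 0 by apply: contraNneq b0B => ->; rewrite mul0r.
have pos (p : {poly K}) : p != 0 -> (0 < size p)%N by rewrite size_poly_gt0.
have b10 : b1 != 0 by rewrite -size_poly_gt0 (leq_trans (pos b bn0)).
have b20 : b2 != 0 by rewrite -size_poly_gt0 (leq_trans (pos b bn0)).
have hM : (size (b1 * b2)%R <= (size b + size b).-1)%N.
  rewrite eqM (leq_trans (size_polyD _ _)) // size_polyN geq_max.
  have size_sqrM (p q : {poly K}) : p != 0 -> size q = 1%N ->
      size (p ^+ 2 * q) = (size p + size p).-1.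
    move=> p0 sq1; have q0 : q != 0 by rewrite -size_poly_eq0 sq1.
    by rewrite size_mul ?expf_neq0 // sq1 expr2 size_mul // addn1.
  by rewrite !size_sqrM // leqnn; move: (size b0) (size b) le0; lia.
have hD : (size (b * (b0 * B))%R <= maxn (size b1) (size b2))%N.
  by rewrite -eqD size_polyD.
exfalso; move: hM hD; rewrite !(@size_mul _ b1, @size_mul _ b) //.
have := pos _ bn0; move: size_b0B le1 le2.
by move: (size (b0 * B)%R) (size b1) (size b2) (size b); lia.
Qed.

(** Induction on the size of [b]. Write [e = a0 + b0 w], [e'] for its conjugate and [u = a + b w].
    The descent puts [u e] or [u e'] into the order, and multiplying by the other conjugate and
    dividing by the norm [k] recovers [u]. If [b = 0], then [a] is constant. *)
Lemma unit_in_unit_order a b : size (qnorm B C a b) = 1%N -> in_unit_order a b.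
Proof.
have /size_poly1P[k k0 defk] := introT eqP size_N0.
have kK : k%:P * k^-1%:P = 1 :> {poly K} by rewrite -polyCM mulfV.
have [s] := ubnP (size b); elim: s => // s IHs in a b *; rewrite ltnS => le_bs size_N.
have [b_eq0|bn0] := eqVneq b 0.
  move: size_N; rewrite /qnorm b_eq0 !(mulr0, mul0r, subr0, expr2) => /eqP.
  rewrite size_mul_eq1 => /andP[/size_poly1P[l _ ->] _].
  by exists l%:P, 0; rewrite comp_polyC comp_poly0 !mul0r addr0.
have scale_unit a' b' : size (qnorm B C a' b') = 1%N -> 
    (size b' < size b)%N -> in_unit_order a' b'.
  by move=> N' lt'; apply: IHs => //; apply: leq_trans le_bs.
have kaE u : u = k^-1%:P * (qnorm B C a0 b0 * u).
  by rewrite defk mulrA [_ * k%:P]mulrC kK mul1r.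
have size_NM N' : N' = qnorm B C a b * qnorm B C a0 b0 -> size N' = 1%N.
  by move=> ->; apply/eqP; rewrite size_mul_eq1 size_N size_N0 eqxx.
have [lt1|lt2] := unit_descent size_N bn0.
- have /scale_unit/(_ lt1)[f [h [e1 e2]]] := size_NM _ (qnormM B C a b a0 b0).
  (* Since [e' = T - e] and [e e' = k], the equation [u e = f(T) + h(T) e] gives
     [k u = T f(T) + k h(T) - f(T) e]. *)
  exists (k^-1%:P * ('X * f + k%:P * h)), ((- k^-1)%:P * f).
  rewrite !(comp_polyD, comp_polyM, comp_polyC, comp_polyX, polyCN, polyCM) -defk; split.
    rewrite [LHS]kaE; have -> : qnorm B C a0 b0 * a =
        (a * a0 + b * b0 * C) * (a0 - b0 * B) - b0 * C * (a * b0 + a0 * b - b * b0 * B) by rewrite /qnorm; ring.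
    by rewrite e1 e2 /qnorm /T; ring.
  rewrite [LHS]kaE; have -> : qnorm B C a0 b0 * b =
      a0 * (a * b0 + a0 * b - b * b0 * B) - b0 * (a * a0 + b * b0 * C) by rewrite /qnorm; ring.
  by rewrite e1 e2; ring.
- have eqN : qnorm B C (a * (a0 - b0 * B) - b * b0 * C) (a0 * b - a * b0)
    = qnorm B C a b * qnorm B C a0 b0 by rewrite /qnorm; ring.
  have /scale_unit/(_ lt2)[f [h [e1 e2]]] := size_NM _ eqN.
  (* Since [e ^+ 2 = T e - k], the equation [u e' = f(T) + h(T) e] gives
     [k u = - k h(T) + (f(T) + T h(T)) e]. *)
  exists ((- (k^-1 * k))%:P * h), (k^-1%:P * (f + 'X * h)).
  rewrite !(comp_polyD, comp_polyM, comp_polyC, comp_polyX, polyCN, polyCM) -defk; split.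
    rewrite [LHS]kaE; have -> : qnorm B C a0 b0 * a =
        (a * (a0 - b0 * B) - b * b0 * C) * a0 + b0 * C * (a0 * b - a * b0) by rewrite /qnorm; ring.
    by rewrite e1 e2 /qnorm /T; ring.
  rewrite [LHS]kaE; have -> : qnorm B C a0 b0 * b =
      (a0 - b0 * B) * (a0 * b - a * b0) + b0 * (a * (a0 - b0 * B) - b * b0 * C) by rewrite /qnorm; ring.
  by rewrite e1 e2 /T; ring.
Qed.

Lemma in_unit_order0 : in_unit_order 0 0.
Proof. by exists 0, 0; rewrite comp_poly0 !mul0r addr0. Qed.

Lemma in_unit_orderB a b a' b' :
  in_unit_order a b -> in_unit_order a' b' -> in_unit_order (a - a') (b - b').
Proof.
move=> [f [h [-> ->]]] [f' [h' [-> ->]]]; exists (f - f'), (h - h').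
by rewrite !comp_polyB; split; ring.
Qed.

(* The order contains [w], so [b0] is constant, and it contains ['X], which is
   then a polynomial in the trace. *)
Lemma unit_order_full : (forall a b, in_unit_order a b) ->
  size b0 = 1%N /\ size B = 2%N.
Proof.
move=> full.
have b0_dvd1 : size b0 = 1%N.
  have [f [h [_ /esym e]]] := full 0 1.
  apply/eqP; move: (size_poly1 K) => /eqP; rewrite -e size_mul_eq1.
  by case/andP.
have b00 : b0 != 0 by rewrite -size_poly_eq0 b0_dvd1.
have size_bB : size (b0 * B)%R = size B.
  have /size_poly1P[k k0 ->] := introT eqP b0_dvd1.
  by rewrite mul_polyC size_scale.
split=> //; have [f [h [e1 /esym/eqP]]] := full 'X 0.
rewrite mulf_eq0 (negPf b00) orbF => /eqP h0.
have sizeT : size T = size B by rewrite /T poly_mulr2n sub0r size_polyN size_bB.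
move: (size_comp_poly f T); rewrite -[f \Po T]addr0 -[X in _ + X](mul0r a0) -h0 -e1.
rewrite size_polyX sizeT => /esym/eqP; rewrite muln_eq1 => /andP[_ /eqP].
by case: (size B) => [|[|]] //= n [->].
Qed.

End Descent.

(** * Degrees of [B] and [C] *)

Lemma coefM_top (p q : {poly K}) m n : (size p <= m.+1)%N -> (size q <= n.+1)%N ->
  (p * q)`_(m + n) = p`_m * q`_n.
Proof.
move=> sp sq; have lt_m : (m < (m + n).+1)%N by rewrite ltnS leq_addr.
rewrite coefM (bigD1 (Ordinal lt_m)) //= addKn big1 ?addr0 // => i.
rewrite -val_eqE /= neq_ltn => /orP[lt_im|lt_mi].
  by rewrite [q`__]nth_default ?mulr0 // (leq_trans sq) // ltn_subRL ltn_add2r.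
by rewrite [p`__]nth_default ?mul0r // (leq_trans sp).
Qed.

Hypothesis qnorm_aniso : forall a b, qnorm B C a b = 0 -> a = 0 /\ b = 0.

(** The alternatives are a constant [C] and a [C] of odd degree; in both, the terms of top degree of
    the norm cannot cancel. *)
Lemma qnorm_size1_trivial a b : B = 1 -> (size C <= 1)%N \/ odd (size C - 1) ->
  size (qnorm B C a b) = 1%N -> (size a <= 1)%N.
Proof.
move=> B1 [/size1_polyC C0|oddC] size_N; rewrite leqNgt; apply/negP=> lt1a.
  (* The leading coefficients would form an isotropic vector of the norm. *)
  set c0 := C`_0 in C0; pose d := (maxn (size a) (size b)).-1.
  have size_d : maxn (size a) (size b) = d.+1.
    by rewrite prednK // leq_max ltnW.
  have [sa sb] : (size a <= d.+1)%N /\ (size b <= d.+1)%N.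
    by rewrite -size_d leq_maxl leq_maxr.
  have : a`_d ^+ 2 - a`_d * b`_d - b`_d ^+ 2 * c0 = 0.
    transitivity ((qnorm B C a b)`_(d + d)).
      rewrite /qnorm B1 mulr1 C0 !expr2 !coefB coefMC !coefM_top //.
    by rewrite nth_default // size_N; move: (size a) (size b) lt1a size_d; lia.
  have NP u v : qnorm B C u%:P v%:P = (u ^+ 2 - u * v - v ^+ 2 * c0)%:P.
    by rewrite /qnorm B1 mulr1 C0 !(polyCB, polyCM, polyC_exp).
  move=> N0; have := NP a`_d b`_d; rewrite N0 => /qnorm_aniso[/eqP + /eqP].
  rewrite !polyC_eq0 => /eqP ad0 /eqP bd0.
  have lead (p : {poly K}) : size p = d.+1 -> p`_d <> 0.
    move=> sp p0; have : lead_coef p = 0 by rewrite lead_coefE sp.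
    by move/eqP; rewrite lead_coef_eq0 -size_poly_eq0 sp.
  by move: size_d; rewrite /maxn; case: ifP => _ => [/lead/(_ bd0)|/lead/(_ ad0)].
have a0 : a != 0 by rewrite -size_poly_gt0 ltnW.
(* [a ^+ 2] and [b ^+ 2 * C] have degrees of different parities. *)
have sizeN : size (qnorm B C a b) = (if b == 0 then (size a + size a).-1 else
    maxn (size a + size a).-1 ((size b + size b).-1 + size C).-1).
  have [->|b0] := eqVneq b 0.
    by rewrite /qnorm !(mulr0, mul0r, subr0, expr0n) expr2 size_mul.
  have C0 : C != 0 by apply: contraTneq oddC => ->; rewrite size_poly0.
  have sA : size (a ^+ 2) = (size a + size a).-1 by rewrite expr2 size_mul.
  have sAB : size (a * b * B) = (size a + size b).-1 by rewrite B1 mulr1 size_mul.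
  have sBC : size (b ^+ 2 * C) = ((size b + size b).-1 + size C).-1.
    by rewrite size_mul ?expf_neq0 // expr2 size_mul.
  have [pa pb] : (0 < size a)%N /\ (0 < size b)%N by rewrite !size_poly_gt0.
  have [lt|ge] := ltnP (size (b ^+ 2 * C)%R) (size (a ^+ 2)%R).
    rewrite /qnorm -addrA size_polyDl; last first.
      rewrite (leq_ltn_trans (size_polyD _ _)) // !size_polyN gtn_max lt andbT sAB sA.
      by move: lt; rewrite sA sBC; move: (size a) (size b) (size C) pa pb oddC; lia.
    rewrite sA; move: lt; rewrite sA sBC.
    by move: (size a) (size b) (size C) pa pb oddC; lia.
  rewrite /qnorm addrC size_polyDl; last first.
    rewrite size_polyN (leq_ltn_trans (size_polyD _ _)) // !size_polyN gtn_max.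
    by move: ge; rewrite sA sBC sAB; move: (size a) (size b) (size C) pa pb oddC; lia.
  rewrite size_polyN; move: ge; rewrite sA sBC.
  by move: (size a) (size b) (size C) pa pb oddC; lia.
move: size_N lt1a; rewrite sizeN.
by case: ifP => _; move: (size a) (size b) (size C); lia.
Qed.

(** The last premise, with [D] ranging over additive properties of coordinate pairs, expresses
    generation by units without mentioning the ring. It is applied to three such properties: to
    exclude [B = 1], to find a unit with [b <> 0], and to show that the order of a minimal unit is
    everything. *)
Lemma norm_one_generated_sizes :
    B \is monic ->
    (size C <= size (B ^+ 2)%R)%N \/ odd (size C - size (B ^+ 2)%R) ->
    (forall D : {poly K} -> {poly K} -> Prop,
      D 0 0 -> (forall a b a' b', D a b -> D a' b' -> D (a - a') (b - b')) ->
      (forall a b, size (qnorm B C a b) = 1%N -> D a b) -> forall a b, D a b) ->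
  size B = 2%N /\
   ((size C <= 2)%N \/
    (size C = 3%N /\ exists a : K, lead_coef C = a ^+ 2 + a)).
Proof.
move=> mB inftyC gen.
have size_B2 : size (B ^+ 2) = (size B + size B).-1.
  by rewrite expr2 size_mul ?monic_neq0.
have size_B_gt1 : (1 < size B)%N.
  rewrite ltn_neqAle eq_sym size_poly_gt0 monic_neq0 // andbT; apply/negP=> sB1.
  have B1 : B = 1.
    by move: mB; rewrite monicE; case/size_poly1P: sB1 => k _ ->; rewrite lead_coefC => /eqP->.
  rewrite B1 expr1n size_poly1 in inftyC.
  suff: (size ('X : {poly K}) <= 1)%N by rewrite size_polyX.
  (* The pairs with constant first entry form an additive group that contains all units but not
     ['X]. *)
  apply: (gen (fun a _ => (size a <= 1)%N) _ _ _ 'X 0) => [|a _ a' _ sa sa'|a b].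
  - by rewrite size_poly0.
  - by rewrite (leq_trans (size_polyD _ _)) // size_polyN geq_max sa.
  - exact: qnorm_size1_trivial.
pose P s := `[< exists a b, [/\ size (qnorm B C a b) = 1%N, b != 0 & size b = s] >].
have exP : exists s, P s.
  apply: contrapT => noP.
  suff: 1 = 0 :> {poly K} by move/eqP; rewrite oner_eq0.
  apply: (gen (fun _ b => b = 0) _ _ _ 0 1) => [//|_ b _ b' -> ->|a b size_N].
    by rewrite subrr.
  apply/eqP/contraT=> b0; case: noP; exists (size b); apply/asboolP.
  by exists a, b.
case: (ex_minnP exP) => s /asboolP[a0 [b0 [size_N0 b00 <-]]] min_b0.
have b0_min a b : size (qnorm B C a b) = 1%N -> b != 0 -> (size b0 <= size b)%N.
  by move=> size_N bn0; apply: min_b0; apply/asboolP; exists a, b.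
have size_b0B : (1 < size (b0 * B)%R)%N.
  rewrite size_mul ?(monic_neq0 mB) //; move: b00; rewrite -size_poly_gt0.
  by move: (size b0) (size B) size_B_gt1; lia.
have [size_b0 size_B] := unit_order_full
  (gen _ (in_unit_order0 a0 b0) (@in_unit_orderB a0 b0)
    (unit_in_unit_order size_N0 b0_min size_b0B)).
split=> //; rewrite size_B2 size_B /= in inftyC.
have /size_poly1P[k k0 defb0] := introT eqP size_b0.
(* As [b0] is the constant [k], dividing by [k] gives a unit [a + w] of norm [N], and its norm
   equation can be solved for [C]. *)
pose a := k^-1%:P * a0; pose N := k^-1%:P ^+ 2 * qnorm B C a0 b0.
have size_N : (size N <= 1)%N.
  have /size_poly1P[l _ defl] := introT eqP size_N0.
  by rewrite /N defl -polyC_exp -polyCM size_polyC_leq1.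
have kk : k^-1%:P * k%:P = 1 :> {poly K} by rewrite -polyCM mulVf.
have defC : C = a ^+ 2 - a * B - N.
  have -> : a * B = k^-1%:P ^+ 2 * (a0 * k%:P * B).
    by rewrite -[LHS]mul1r -kk /a; ring.
  rewrite -[LHS]mul1r -(expr1n _ 2) -kk /N /a /qnorm defb0; ring.
have sizeB_le : (size B <= 2)%N by rewrite size_B.
have [le_a2|gt_a2] := leqP (size a) 2.
  have [leC2|gtC2] := leqP (size C) 2; [by left | right].
  have size_C : size C = 3%N.
    apply/eqP; rewrite eqn_leq gtC2 andbT defC.
    rewrite (leq_trans (size_polyD _ _)) // size_polyN geq_max.
    rewrite (leq_trans size_N) // andbT.
    rewrite (leq_trans (size_polyD _ _)) // size_polyN geq_max expr2.
    rewrite !(leq_trans (size_polyMleq _ _)) //;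
      by move: (size a) (size B) le_a2 sizeB_le; lia.
  split=> //; exists a`_1; rewrite lead_coefE size_C /=.
  rewrite defC 2!coefB [N`__]nth_default ?(leq_trans size_N) // subr0 expr2.
  rewrite (@coefM_top _ _ 1 1) // (@coefM_top _ _ 1 1) //.
  have -> : B`_1 = 1 by move: mB; rewrite monicE lead_coefE size_B => /eqP.
  rewrite mulr1 expr2; congr (_ + _).
  by apply: polyC_inj; rewrite polyCN poly_oppr.
(* When [a] has degree at least 2, [a ^+ 2] dominates, so [C] has even degree greater than that of
   [B ^+ 2]: a pole of even order at infinity. *)
have a_neq0 : a != 0 by rewrite -size_poly_gt0 ltnW // ltnW.
have size_aB : size (a * B) = (size a).+1.
  by rewrite size_mul ?(monic_neq0 mB) // size_B addn2.
have size_a2 : size (a ^+ 2) = (size a + size a).-1 by rewrite expr2 size_mul.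
have size_C : size C = (size a + size a).-1.
  rewrite defC -addrA size_polyDl // size_a2.
  rewrite (leq_ltn_trans (size_polyD _ _)) // !size_polyN gtn_max size_aB.
  by move: (size a) (size N) gt_a2 size_N; lia.
by exfalso; move: inftyC; rewrite size_C; move: (size a) gt_a2; lia.
Qed.

Lemma exists_norm_const :
    B \is monic -> size B = 2%N ->
    (size C <= 2)%N \/
      (size C = 3%N /\ exists a : K, lead_coef C = a ^+ 2 + a) ->
  exists a (k : K), qnorm B C a 1 = k%:P.
Proof.
move=> mB size_B hypC.
have opp_eq (x : K) : - x = x by apply: polyC_inj; rewrite polyCN poly_oppr.
have [size_C [a1 C2]] : (size C <= 3)%N /\ exists a1 : K, C`_2 = a1 ^+ 2 - a1.
  case: hypC => [le_C2|[size_C [a1]]].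
    by split; [apply: leqW | exists 0; rewrite nth_default // expr0n subrr].
  rewrite lead_coefE size_C => C2; split=> //.
  by exists a1; rewrite C2 opp_eq.
have defB : B = 'X + (B`_0)%:P.
  have B1 : B`_1 = 1 by move: mB; rewrite monicE lead_coefE size_B => /eqP.
  apply/polyP => -[|[|i]]; rewrite coefD coefX coefC /= ?add0r ?addr0 ?B1 //.
  by rewrite nth_default // size_B.
have defC : C = (a1 ^+ 2 - a1)%:P * 'X^2 + (C`_1)%:P * 'X + (C`_0)%:P.
  apply/polyP => -[|[|[|i]]]; rewrite !coefD !coefCM coefXn coefX coefC /=.
  - by rewrite !mulr0 !add0r.
  - by rewrite mulr0 mulr1 add0r addr0.
  - by rewrite mulr0 mulr1 !addr0.
  - by rewrite !mulr0 !addr0 nth_default // (leq_trans size_C).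
(* In [a ^+ 2 - a * B - C] the quadratic coefficient vanishes by the choice of [a1]; [d] is chosen
   to kill the linear one, where [2 a1 d] drops out in characteristic 2. *)
pose d := - (a1 * B`_0 + C`_1).
exists (a1%:P * 'X + d%:P), (d ^+ 2 - d * B`_0 - C`_0).
rewrite /qnorm {1}defB {1}defC /d.
rewrite -[RHS]addr0 -(poly_mulr2n (a1%:P * (- (a1 * B`_0 + C`_1))%:P * 'X)).
rewrite !(polyCB, polyCN, polyCD, polyCM, polyC_exp).
by ring.
Qed.

End NormOne.

Lemma norm_clear_den (L : fieldType) (u v s t : L) : s != 0 ->
  (s * u) ^+ 2 - s * u * v * s - v ^+ 2 * t
  = s ^+ 2 * (u ^+ 2 - u * v - v ^+ 2 * (t / s ^+ 2)).
Proof. by move=> s0; field. Qed.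

(** * Quadratic extensions in characteristic 2 *)

Section ArtinSchreier.
Variables (k : fieldType) (c : k).
Local Notation M := ('X^2 + 'X - c%:P).

Lemma size_artin_schreier : size M = 3.
Proof.
rewrite -addrA size_polyDl size_polyXn //.
rewrite (leq_ltn_trans (size_polyD _ _)) // size_polyX size_polyN gtn_max.
by rewrite (leq_ltn_trans (size_polyC_leq1 _)).
Qed.

Lemma size_mod_artin_schreier q : (size (q %% M)%R <= 2)%N.
Proof.
have /(ltn_modpN0 q) : M != 0 by rewrite -size_poly_eq0 size_artin_schreier.
by rewrite size_artin_schreier ltnS.
Qed.

Lemma root_artin_schreier (L : fieldType) (j : {rmorphism k -> L}) z :
  z ^+ 2 + z = j c -> (map_poly j M).[z] = 0.
Proof.
move=> eqz; rewrite !rmorphB !rmorphD /= map_polyXn map_polyX map_polyC /=.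
by rewrite !hornerE eqz subrr.
Qed.

(** The value at [y] of a polynomial depends only on its remainder modulo [M], which is linear. *)
Lemma adjoin_artin_schreier_coord (L : fieldExtType k) (y : L) :
    y ^+ 2 + y = c%:A -> <<1; y>>%VS = fullv ->
  forall u, exists al be, u = in_alg L al + in_alg L be * y.
Proof.
move=> eqy genL u.
have /Fadjoin_polyP[_ /polyOver1P[q ->] ->] : u \in <<1; y>>%VS.
  by rewrite genL memvf.
exists (q %% M)`_0, (q %% M)`_1.
rewrite {1}(divp_eq q M) rmorphD rmorphM hornerD hornerM.
rewrite root_artin_schreier // mulr0 add0r.
rewrite (@horner_coef_wide _ 2) ?size_map_poly ?size_mod_artin_schreier //.
by rewrite !big_ord_recl big_ord0 !coef_map expr0 expr1 mulr1 addr0.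
Qed.

End ArtinSchreier.

(** * Integral elements and units of the quadratic extension *)

Section QuadraticExtension.
Variables (K : fieldType) (charK : 2%N \in [pchar K]).
Variables (F : fieldType) (j : {rmorphism {fraction {poly K}} -> F}) (y : F).
Variables (B C : {poly K}) (c : {fraction {poly K}}).
Hypothesis B_neq0 : B != 0.
Hypothesis defc : c = tofrac C / tofrac B ^+ 2.
Hypothesis irr : irreducible_poly ('X^2 + 'X - c%:P).
Hypothesis eqy : y ^+ 2 + y = j c.
Hypothesis quad_coord : forall u, exists al be, u = j al + j be * y.
Hypothesis dvdB : forall a b, B ^+ 2 %| qnorm B C a b -> B %| a /\ B %| b.

Local Notation iota := (j \o @tofrac {poly K}).
Local Notation M := ('X^2 + 'X - c%:P).
Local Notation w := (j (tofrac B) * y).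
Local Notation qelt a b := (j (tofrac a) + j (tofrac b) * w).
Local Notation O := (integral_closure iota).

Let size_M : size M = 3 := size_artin_schreier c.
Let size_modM q : (size (q %% M)%R <= 2)%N := size_mod_artin_schreier c q.

Let M_y (z : F) : z ^+ 2 + z = j c -> (map_poly j M).[z] = 0 :=
  @root_artin_schreier _ _ _ _ _.

(** A relation with [be <> 0] would put [y] into the base field and give [M] a linear factor. *)
Lemma quad_free al be : j al + j be * y = 0 -> al = 0 /\ be = 0.
Proof.
have [-> | be0] := eqVneq be 0.
  by rewrite rmorph0 mul0r addr0 => /eqP; rewrite fmorph_eq0 => /eqP.
move=> eq0; pose z := - al / be.
have yz : y = j z.
  have jb0 : j be != 0 by rewrite fmorph_eq0.
  rewrite fmorph_div rmorphN /=; apply: (canRL (mulfK jb0)).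
  by apply/eqP; rewrite mulrC -addr_eq0 addrC eq0.
have : 'X - z%:P %| M.
  rewrite dvdp_XsubCl; apply/rootP/(fmorph_inj j).
  by rewrite rmorph0 -horner_map -yz M_y.
case: irr => _ irr2 /irr2; rewrite size_XsubC => /(_ isT) /eqp_size eq_size.
by move: size_M; rewrite -eq_size size_XsubC.
Qed.

(* [- 1 - y] is the other root of [M], and [M] divides every polynomial over
   the base field that vanishes at [y]. *)
Lemma quad_conj_root (q : {poly {fraction {poly K}}}) al be :
    (map_poly j q).[j al + j be * y] = 0 ->
  (map_poly j q).[j al + j be * (- 1 - y)] = 0.
Proof.
pose q1 := q \Po (al%:P + be *: 'X).
have q1E z : (map_poly j q).[j al + j be * z] = (map_poly j q1).[z].
  by rewrite map_comp_poly horner_comp rmorphD /= map_polyC map_polyZ map_polyX !hornerE.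
rewrite !q1E.
rewrite (divp_eq q1 M) !rmorphD !rmorphM /= !hornerD !hornerM !M_y //; last first.
  by rewrite -eqy; ring.
rewrite !mulr0 !add0r !(@horner_coef_wide _ 2) ?size_map_poly ?size_modM //.
rewrite !big_ord_recl !big_ord0 /= !coef_map /= !expr0 !expr1 !mulr1 !addr0.
by move=> /quad_free[-> ->]; rewrite !rmorph0 mul0r addr0.
Qed.

Lemma w_sqr : w ^+ 2 = j (tofrac C) - j (tofrac B) * w.
Proof.
have -> : j (tofrac C) = j (tofrac B) ^+ 2 * (y ^+ 2 + y).
  rewrite eqy defc fmorph_div rmorphXn /= mulrC divfK //.
  by rewrite expf_neq0 // fmorph_eq0 tofrac_eq0.
by ring.
Qed.

Lemma qelt_integral a b : integralOver iota (qelt a b).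
Proof.
have w_int : integralOver iota w.
  exists ('X^2 + (B *: 'X - C%:P)).
    rewrite monicE lead_coefDl ?lead_coefXn // size_polyXn ltnS.
    rewrite (leq_trans (size_polyD _ _)) // size_polyN geq_max.
    rewrite (leq_trans (size_scale_leq _ _)) ?size_polyX //.
    by rewrite (leq_trans (size_polyC_leq1 _)).
  apply/rootP; rewrite rmorphD rmorphB /= map_polyXn map_polyZ map_polyX map_polyC /=.
  by rewrite !(hornerD, hornerN, hornerZ, hornerXn, hornerX, hornerC) w_sqr /=; ring.
by apply/integral_add/integral_mul => //; apply: integral_id.
Qed.

Lemma integral_fraction al : integralOver iota (j al) -> exists a, al = tofrac a.
Proof.
case=> q mon_q; rewrite map_poly_comp /= fmorph_root => q_al.
by apply: fraction_poly_integral; exists q.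
Qed.

Lemma two_eq0 : 2%:R = 0 :> F.
Proof. by rewrite -(rmorph_nat (iota \o polyC)) (pcharf0 charK) rmorph0. Qed.

(** Trace and norm of an integral element are polynomials; with the divisibility hypothesis [dvdB]
    this clears the denominator [B] from its coordinates. *)
Lemma integral_coord u : integralOver iota u -> exists a b, u = qelt a b.
Proof.
have [al [be ->]] := quad_coord u => u_int.
have u'_int : integralOver iota (j al + j be * (- 1 - y)).
  case: u_int => q mon_q; rewrite map_poly_comp /= => /rootP/quad_conj_root q0.
  by exists q => //; rewrite map_poly_comp; apply/rootP.
(* The trace of [u] is [2 al - be], which only gives [be] in characteristic 2. *)
have [b defb] : exists b, be = tofrac b.
  apply: integral_fraction; have := integral_opp (integral_add u_int u'_int).
  have -> // : - (j al + j be * y + (j al + j be * (- 1 - y))) = j be.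
  rewrite -[RHS]subr0 -(mul0r (j al)) -two_eq0; ring.
have [d defd] : exists d, al ^+ 2 - al * be - be ^+ 2 * c = tofrac d.
  apply: integral_fraction; have := integral_mul u_int u'_int.
  have -> // : (j al + j be * y) * (j al + j be * (- 1 - y))
             = j (al ^+ 2 - al * be - be ^+ 2 * c).
  by rewrite !(rmorphB, rmorphM, rmorphXn) /= -eqy; ring.
(* Subtracting the integral element [b w] from [B u] leaves [B al]. *)
have [A defA] : exists A, tofrac B * al = tofrac A.
  apply: integral_fraction.
  have -> : j (tofrac B * al) = j (tofrac B) * (j al + j be * y) - j (tofrac b) * w.
    by rewrite defb rmorphM /= ; ring.
  apply: integral_sub; first by apply: integral_mul => //; apply: integral_id.
  by have := qelt_integral 0 b; rewrite rmorph0 add0r.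
have tB0 : tofrac B != 0 by rewrite tofrac_eq0.
have dvdN : B ^+ 2 %| qnorm B C A b.
  suff -> : qnorm B C A b = B ^+ 2 * d by apply: dvdp_mulr.
  apply: tofrac_inj.
  rewrite /qnorm !(rmorphB, rmorphM, rmorphXn) /= -defA -defb -defd defc.
  exact: norm_clear_den.
have [/dvdpP[a1 defA1] /dvdpP[b1 defb1]] := dvdB dvdN.
exists a1, b1; rewrite defb defb1 rmorphM /=.
have -> : al = tofrac a1.
  by apply: (mulfI tB0); rewrite defA defA1 rmorphM mulrC.
by rewrite !rmorphM /= ;ring.
Qed.

Lemma qelt_inj a b a' b' : qelt a b = qelt a' b' -> a = a' /\ b = b'.
Proof.
move=> eq_q.
have : j (tofrac (a - a')) + j (tofrac ((b - b') * B)) * y = 0.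
  rewrite !(rmorphB, rmorphM) /=.
  transitivity (qelt a b - qelt a' b'); last by rewrite eq_q subrr.
  by rewrite /=; ring.
case/quad_free => /eqP + /eqP; rewrite !tofrac_eq0 mulf_eq0 (negPf B_neq0) orbF.
by rewrite !subr_eq0 => /eqP-> /eqP->.
Qed.

Lemma qeltM a b a' b' :
  qelt a b * qelt a' b' =
  qelt (a * a' + b * b' * C) (a * b' + a' * b - b * b' * B).
Proof.
rewrite !(rmorphD, rmorphN, rmorphM) /=.
transitivity (j (tofrac a) * j (tofrac a') + j (tofrac b) * j (tofrac b') * w ^+ 2
              + (j (tofrac a) * j (tofrac b') + j (tofrac a') * iota b) * w).
  by ring.
by rewrite w_sqr; ring.
Qed.

(** The norms of a unit and of its inverse are polynomials with product 1. *)
Lemma unit_coord (u : O) : u \is a GRing.unit ->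
  exists a b, ic_val u = qelt a b /\ size (qnorm B C a b) = 1%N.
Proof.
move=> Uu.
have /integral_coord[a [b defu]] : integralOver iota (ic_val u).
  by apply/integral_predP; case: (u).
have /integral_coord[a' [b' defv]] : integralOver iota (ic_val u^-1).
  by apply/integral_predP; case: (u^-1).
exists a, b; split=> //.
have: ic_val (u * u^-1) = qelt 1 0 by rewrite divrr // rmorph0 rmorph1 mul0r addr0.
rewrite [LHS](_ : _ = ic_val u * ic_val u^-1) // defu defv qeltM.
move=> /qelt_inj[e1 e2]; have := qnormM B C a b a' b'.
have N1 : qnorm B C 1 0 = 1 by rewrite /qnorm; ring.
rewrite e1 e2 N1 => eN; have := size_poly1 K.
by rewrite eN => /eqP; rewrite size_mul_eq1 => /andP[/eqP].
Qed.

(** Pulled back along the coordinates, [D] becomes an additive subgroup of [O] containing every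
    unit. *)
Lemma generated_coord (D : {poly K} -> {poly K} -> Prop) :
    generated_by_units O ->
    D 0 0 -> (forall a b a' b', D a b -> D a' b' -> D (a - a') (b - b')) ->
    (forall a b, size (qnorm B C a b) = 1%N -> D a b) ->
  forall a b, D a b.
Proof.
move=> gen D0 Dsub Dunit a b.
pose S : {pred O} := fun r => `[< exists a b, ic_val r = qelt a b /\ D a b >].
have SP r : reflect (exists a b, ic_val r = qelt a b /\ D a b) (r \in S).
  exact: asboolP.
have S_zmod : zmod_closed S.
  split=> [|r s /SP[a1 [b1 [e1 D1]]] /SP[a2 [b2 [e2 D2]]]]; apply/SP.
    by exists 0, 0; rewrite !rmorph0 mul0r addr0.
  exists (a1 - a2), (b1 - b2); split; last exact: Dsub.
  transitivity (ic_val r - ic_val s) => //.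
  by rewrite e1 e2 !rmorphB /=; ring.
have S_unit e : e \is a GRing.unit -> e \in S.
  move=> /unit_coord[a1 [b1 [e1 N1]]]; apply/SP; exists a1, b1.
  by split=> //; apply: Dunit.
have r_int : qelt a b \in integral_pred iota by apply/integral_predP/qelt_integral.
have /SP[a1 [b1 [/= + D1]]] := gen S S_zmod S_unit (IntegralClosure r_int).
by case/qelt_inj => -> ->.
Qed.


Lemma qnormE a b : qelt a b * qelt (a - b * B) (- b) = j (tofrac (qnorm B C a b)).
Proof.
rewrite qeltM -[RHS]addr0 -(mul0r w) -[in RHS](rmorph0 iota) /=.
by congr (j (tofrac _) + j (tofrac _) * w); rewrite /qnorm; ring.
Qed.

Lemma qnorm_eq0 a b : qnorm B C a b = 0 -> a = 0 /\ b = 0.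
Proof.
have q0 a' b' : qelt a' b' = 0 -> a' = 0 /\ b' = 0.
  by move=> e; apply: qelt_inj; rewrite e !rmorph0 mul0r addr0.
move=> N0; have := qnormE a b; rewrite N0 !rmorph0 => /eqP.
rewrite mulf_eq0 => /orP[/eqP/q0//|/eqP/q0[e1 /eqP]].
rewrite oppr_eq0 => /eqP b0; split=> //.
by move: e1; rewrite b0 mul0r subr0.
Qed.

(** * Rings of Laurent polynomials *)

Section LaurentRing.
Variables (a0 : {poly K}) (k : K).
Hypothesis norm_eps : qnorm B C a0 1 = k%:P.
Hypothesis B_monic : B \is monic.
Hypothesis size_B : size B = 2%N.

Local Notation cst := (j \o (@tofrac {poly K} \o polyC)).
Local Notation eps := (qelt a0 1).
Local Notation eps' := (qelt (a0 - B) (- 1)).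

Let eps_conj : eps * eps' = cst k.
Proof. by rewrite /= -norm_eps -qnormE mul1r. Qed.

Let k_neq0 : k != 0.
Proof.
apply: contraTneq (oner_neq0 {poly K}) => k0; rewrite negbK; apply/eqP.
by case: (@qnorm_eq0 a0 1) => //; rewrite norm_eps k0.
Qed.

Let eps_neq0 : eps != 0.
Proof.
apply: contraNneq k_neq0 => e0; have := eps_conj.
by rewrite e0 mul0r => /esym/eqP; rewrite fmorph_eq0.
Qed.

(** In characteristic 2 the trace [eps + eps'] is [- B]. This expresses [B], and with it ['X],
    through [eps] and its inverse. *)
Let epsB : eps * j (tofrac B) = - eps ^+ 2 - cst k.
Proof.
have tr : eps + eps' + j (tofrac B) = 2%:R * j (tofrac a0).
  by rewrite !(rmorphB, rmorphN, rmorph1) /=; ring.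
rewrite -eps_conj -[RHS]addr0 -(mul0r (eps * j (tofrac a0))) -[in RHS]two_eq0.
have -> : j (tofrac B) = 2%:R * j (tofrac a0) - eps - eps' by rewrite -tr; ring.
by ring.
Qed.

Let X_coord : 'X = B - (B`_0)%:P.
Proof.
have B1 : B`_1 = 1 by move: B_monic; rewrite monicE lead_coefE size_B => /eqP.
apply/polyP => -[|[|i]]; rewrite coefX coefB coefC /= ?subrr ?subr0 ?B1 //.
by rewrite nth_default // size_B.
Qed.

Lemma eps_transcendental (f : {poly K}) : (map_poly cst f).[eps] = 0 -> f = 0.
Proof.
move=> f0; apply/eqP/contraT => fn0.
(* Otherwise ['X], which is rational in [eps], would be algebraic over [K]. *)
have alg_cst z : algebraicOver cst (cst z) by apply: algebraic_id.
have alg_eps : algebraicOver cst eps by exists f => //; apply/rootP.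
have alg_X : algebraicOver cst (j (tofrac 'X)).
  have -> : j (tofrac 'X) = (- eps ^+ 2 - cst k) / eps - cst B`_0.
    by rewrite -epsB mulrAC mulfV // mul1r {1}X_coord !rmorphB.
  apply: algebraic_sub => //; apply: algebraic_div => //; apply: algebraic_sub => //.
  by apply: algebraic_opp; rewrite expr2; apply: algebraic_mul.
have [q q0 /rootP] := alg_X.
have -> : (map_poly cst q).[j (tofrac 'X)] = j (tofrac q).
  rewrite map_poly_comp horner_map map_poly_comp /= horner_map /=.
  by rewrite -[_.['X]]/(q \Po 'X) comp_polyXr.
by move/eqP; rewrite fmorph_eq0 tofrac_eq0 (negPf q0).
Qed.

(** Membership in [K[eps, 1/eps]], with the denominator cleared. *)
Definition laurent (r : F) :=
  exists n (f : {poly K}), eps ^+ n * r = (map_poly cst f).[eps].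

Lemma laurent_cst z : laurent (cst z).
Proof. by exists 0%N, z%:P; rewrite map_polyC hornerC mul1r. Qed.

Lemma laurentD r s : laurent r -> laurent s -> laurent (r + s).
Proof.
move=> [n [f ef]] [m [h eh]]; exists (n + m)%N, ('X^m * f + 'X^n * h).
rewrite rmorphD !rmorphM /= !map_polyXn hornerD !hornerM !hornerXn -ef -eh.
by rewrite exprD; ring.
Qed.

Lemma laurentM r s : laurent r -> laurent s -> laurent (r * s).
Proof.
move=> [n [f ef]] [m [h eh]]; exists (n + m)%N, (f * h).
by rewrite rmorphM hornerM -ef -eh exprD; ring.
Qed.

Lemma laurent_eps : laurent eps.
Proof. by exists 0%N, 'X; rewrite map_polyX hornerX mul1r. Qed.

Lemma laurent_poly a : laurent (j (tofrac a)).
Proof.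
have lX : laurent (j (tofrac 'X)).
  rewrite X_coord !rmorphB /=; apply: laurentD; last first.
    by rewrite -!rmorphN; apply: laurent_cst.
  exists 1%N, (- 'X^2 - k%:P).
  by rewrite expr1 epsB rmorphB rmorphN /= map_polyXn map_polyC !hornerE.
elim/poly_ind: a => [|a z la]; first by have := laurent_cst 0; rewrite /= polyC0.
rewrite !rmorphD !rmorphM; apply: laurentD (laurent_cst z).
exact: laurentM.
Qed.

Lemma laurent_qelt a b : laurent (qelt a b).
Proof.
apply: laurentD; first exact: laurent_poly.
apply: laurentM; first exact: laurent_poly.
have -> : w = eps + j (tofrac (- a0)) by rewrite !(rmorphN, rmorph1) /=; ring.
by apply: laurentD; [apply: laurent_eps | apply: laurent_poly].
Qed.

Let eps_int : eps \in integral_pred iota.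
Proof. by apply/integral_predP/qelt_integral. Qed.

Let epsV_int : cst k^-1 * eps' \in integral_pred iota.
Proof.
apply/integral_predP/integral_mul; last exact: qelt_integral.
exact: (integral_id iota).
Qed.

Let cst_int z : cst z \in integral_pred iota.
Proof. by apply/integral_predP; apply: (integral_id iota). Qed.

Let e : O := IntegralClosure eps_int.
Let co z : O := IntegralClosure (cst_int z).

Let e_unit : e \is a GRing.unit.
Proof.
apply: (@ic_unitP _ _ _ e (IntegralClosure epsV_int)).
apply: val_inj; rewrite [LHS](_ : _ = cst k^-1 * eps' * eps) //.
by rewrite -mulrA [eps' * _]mulrC eps_conj -rmorphM mulVf // rmorph1.
Qed.

Let co_unit z : z != 0 -> co z \is a GRing.unit.
Proof.
move=> z0; apply: (@ic_unitP _ _ _ (co z) (co z^-1)).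
apply: val_inj; rewrite [LHS](_ : _ = cst z^-1 * cst z) //.
by rewrite -rmorphM mulVf // rmorph1.
Qed.

Lemma laurent_generated : generated_by_units O.
Proof.
move=> S [S0 SB] S_unit r.
have SN s : s \in S -> - s \in S by move=> Ss; rewrite -[- s]add0r SB.
have SD s t : s \in S -> t \in S -> s + t \in S.
  by move=> Ss St; rewrite -[t]opprK SB // SN.
have /integral_coord[a [b defr]] : integralOver iota (ic_val r).
  by apply/integral_predP; case: (r).
have [n [f ef]] := laurent_qelt a b.
have -> : r = \sum_(i < size f) co f`_i * e ^+ i * e^-1 ^+ n.
  have en_unit : e ^+ n \is a GRing.unit by rewrite unitrX.
  rewrite -mulr_suml exprVn; apply: (canRL (mulrK en_unit)).
  apply: val_inj; rewrite rmorph_sum [LHS](_ : _ = qelt a b * eps ^+ n); last first.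
    by rewrite rmorphM rmorphXn /= -defr.
  rewrite mulrC ef horner_coef size_map_poly; apply: eq_bigr => i _.
  by rewrite coef_map rmorphM rmorphXn.
apply: (big_ind (fun s => s \in S)) => // i _.
(* Terms with a nonzero coefficient are units; the others are zero, which [S] contains as well. *)
have [f0|fn0] := eqVneq f`_i 0; last first.
  by apply: S_unit; rewrite !unitrM co_unit // !unitrX ?unitrV.
suff -> : co f`_i = 0 by rewrite !mul0r.
by apply: val_inj; rewrite f0 /= !rmorph0.
Qed.

(** After clearing denominators, [u] and its inverse become polynomials in [eps] whose product is a
    power of [eps]. As [eps] is transcendental, each is a constant times a power of it. *)
Lemma laurent_unit (u : O) : u \is a GRing.unit ->
  exists n z i, eps ^+ n * ic_val u = cst z * eps ^+ i.
Proof.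
move=> Uu.
have lau (v : O) : laurent (ic_val v).
  have /integral_coord[a [b ->]] : integralOver iota (ic_val v).
    by apply/integral_predP; case: (v).
  exact: laurent_qelt.
have [n [f ef]] := lau u; have [m [h eh]] := lau u^-1.
have uV : ic_val u * ic_val u^-1 = 1.
  by transitivity (ic_val (u * u^-1)) => //; rewrite divrr.
have fh : f * h = 'X^(n + m).
  apply/eqP; rewrite -subr_eq0; apply/eqP/eps_transcendental.
  rewrite rmorphB rmorphM /= map_polyXn hornerD hornerN hornerM hornerXn -ef -eh.
  by rewrite mulrACA uV mulr1 exprD subrr.
have /dvdp_exp_XsubCP[i _ /eqpP[[c1 c2] /= /andP[c1n0 c2n0] ec]] :
    f %| ('X - 0%:P) ^+ (n + m).
  by rewrite subr0 -fh dvdp_mulr.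
exists n, (c1^-1 * c2), i; rewrite ef.
have -> : f = (c1^-1 * c2) *: 'X^i.
  by rewrite -scalerA -['X]subr0 -polyC0 -ec scalerA mulVf // scale1r.
by rewrite map_polyZ map_polyXn hornerZ hornerXn.
Qed.

(* A sum of [n] units is, up to a power of [eps], a polynomial in [eps] with at
   most [n] nonzero coefficients. *)
Lemma laurent_not_good n : ~ good_ring O n.
Proof.
case=> n0 /(_ (\sum_(t < n.+1) e ^+ t))[u [Uu eu]].
have /fin_all_exists[N /fin_all_exists[z /fin_all_exists[d ud]]] :=
  fun i => laurent_unit (Uu i).
(* [N0] bounds every [N i], so one power of [eps] clears all denominators at once. *)
pose N0 := (\sum_i N i)%N; pose d0 i := (N0 - N i + d i)%N.
have eq_poly : \sum_(t < n.+1) 'X^(N0 + t) = \sum_i z i *: 'X^(d0 i).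
  apply/eqP; rewrite -subr_eq0; apply/eqP/eps_transcendental.
  rewrite rmorphB !rmorph_sum /= hornerD hornerN !horner_sum.
  have := congr1 (fun v : O => eps ^+ N0 * (val v : F)) eu.
  rewrite !(rmorph_sum (val : {rmorphism O -> F})) !mulr_sumr => eqv.
  apply/eqP; rewrite subr_eq0; apply/eqP; etransitivity; last (etransitivity; first exact: eqv).
    by apply: eq_bigr => t _; rewrite map_polyXn hornerXn exprD rmorphXn.
  apply: eq_bigr => i _; rewrite map_polyZ map_polyXn hornerZ hornerXn /d0 exprD.
  have leN : (N i <= N0)%N by rewrite /N0 (bigD1 i) //= leq_addr.
  have /= udi := ud i.
  by rewrite [RHS]mulrCA -udi [RHS]mulrA -exprD subnK.
(* Each of the [n.+1] exponents on the left must occur among the [n] exponents on the right, which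
   contradicts the pigeonhole principle. *)
have ex_i (t : 'I_n.+1) : exists i, d0 i = (N0 + t)%N.
  apply: contrapT => no_i.
  have := congr1 (fun f : {poly K} => f`_(N0 + t)) eq_poly.
  rewrite !coef_sum (bigD1 t) //= coefXn eqxx big1 => [|t' ne_t]; last first.
    by rewrite coefXn eqn_add2l eq_sym val_eqE (negPf ne_t).
  rewrite addr0 big1 => [/eqP|i _]; first by rewrite oner_eq0.
  rewrite coefZ coefXn; case: eqP => [eqi|]; last by rewrite mulr0.
  by case: no_i; exists i.
have /fin_all_exists[s ds] := ex_i.
have inj_s : injective s.
  by move=> t t' eq_s; apply/val_inj/(@addnI N0); rewrite -!ds eq_s.
by have := leq_card s inj_s; rewrite !card_ord ltnn.
Qed.

End LaurentRing.

End QuadraticExtension.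

(** * Unit sum number omega and the equivalence *)

Lemma unit_sum_number_omega (R : unitRingType) :
  unit_sum_number R = usn_omega <->
  (forall k, ~ good_ring R k) /\ generated_by_units R.
Proof.
rewrite /unit_sum_number; split; last first.
  case=> no gen; case: pselect => [ex_k|_]; last by case: pselect.
  by case: (ex_k) => k gk; case: (no k gk).
case: pselect => // no; case: pselect => // gen _; split=> // k gk.
by apply: no; exists k.
Qed.

Theorem corollary2 (K : finFieldType) (charK : 2%N \in [pchar K])
    (F : fieldExtType {fraction {poly K}}) (y : F)
    (m : nat) (p : 'I_m -> {poly K}) (n : 'I_m -> nat) (g : {poly K})
    (hnf : hasse_normal_form p n g)
    (B : {poly K}) (defB : B = hasse_B p n)
    (C : {poly K}) (defC : C = hasse_C p g)
    (c : {fraction {poly K}})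
    (defc : c = FracField.tofrac C / FracField.tofrac B ^+ 2)
    (irr : irreducible_poly ('X^2 + 'X - c%:P))
    (eqy : y ^+ 2 + y = c%:A)
    (genF : <<1; y>>%VS = fullv) :
  unit_sum_number 'O_F = usn_omega
  <->
  (size B = 2%N /\
   ((size C <= 2)%N \/
    (size C = 3%N /\ exists a : K, lead_coef C = a ^+ 2 + a))).
Proof.
have mB : B \is monic by rewrite defB; apply: hasse_B_monic hnf.
have B0 := monic_neq0 mB.
have dvdB a b : B ^+ 2 %| qnorm B C a b -> B %| a /\ B %| b.
  by rewrite defB defC; apply: hasse_dvdp hnf _ _.
pose j : {rmorphism {fraction {poly K}} -> F} := in_alg F.
have eqj : y ^+ 2 + y = j c := eqy.
have coord := adjoin_artin_schreier_coord eqy genF.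
apply: iff_trans (unit_sum_number_omega _) _; split=> [[_ gen]|[size_B hypC]].
  apply: (norm_one_generated_sizes charK) => //.
  - exact: qnorm_eq0 B0 defc irr eqj.
  - by rewrite defB defC; apply: hasse_infty hnf.
  move=> D D0 DB DU a b.
  exact (generated_coord charK B0 defc irr eqj coord dvdB gen D0 DB DU a b).
have [a0 [k norm_eps]] := exists_norm_const charK mB size_B hypC.
split=> [d|].
  exact: (laurent_not_good charK B0 defc irr eqj coord dvdB norm_eps mB size_B).
exact: (laurent_generated charK B0 defc irr eqj coord dvdB norm_eps mB size_B).
Qed.
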